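(* Let $p$ be an odd prime and $n$ a positive integer. Let $g(x)\in\mathbb{F}_{p^n}[x]$ be a planar Dembowski-Ostrom monomial. For any $\alpha,\beta\in\mathbb{F}_{p^n}^*$, the element $X:=M_{g,\beta}M_{g,\alpha}^{-1}\in\mathrm{Quot}(\mathcal{D}_g)$ generates a field isomorphic to $\mathbb{F}_p(\alpha^{-1}\beta)$, namely $\mathbb{F}_p[X]$, and $\mathbb{F}_p[X]\subseteq\mathrm{Quot}(\mathcal{D}_g)$.
   Context: A Dembowski-Ostrom (DO) polynomial in $\mathbb{F}_{p^n}[x]$ is one of the form $\sum_{0\le i\le j\le n-1}u_{i,j}x^{p^i+p^j}$ with $u_{i,j}\in\mathbb{F}_{p^n}$; a DO monomial is a DO polynomial of the form $x^d$. For a polynomial $g$ and $\alpha\in\mathbb{F}_{p^n}$, $\Delta_{g,\alpha}(x)=g(x+\alpha)-g(x)-g(\alpha)$; $g$ is planar if for every $\alpha\in\mathbb{F}_{p^n}^*$ the evaluation map of $\Delta_{g,\alpha}$ is a bijection of $\mathbb{F}_{p^n}$. If $g$ is DO, the evaluation map of $\Delta_{g,\alpha}$ is $\mathbb{F}_p$-linear; fix an $\mathbb{F}_p$-basis of $\mathbb{F}_{p^n}$ and let $M_{g,\alpha}$ be the $n\times n$ matrix over $\mathbb{F}_p$ of this map. $\mathcal{D}_g=\{M_{g,\alpha}\mid\alpha\in\mathbb{F}_{p^n}\}$ and $\mathrm{Quot}(\mathcal{D}_g)=\{XY^{-1}\mid X,Y\in\mathcal{D}_g,\ Y\text{ invertible}\}$.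 $\mathbb{F}_p[X]$ is the $\mathbb{F}_p$-subalgebra of $\mathrm{Mat}_{\mathbb{F}_p}(n,n)$ generated by $X$, and $\mathbb{F}_p(\alpha^{-1}\beta)$ is the subfield of $\mathbb{F}_{p^n}$ generated by $\alpha^{-1}\beta$ over $\mathbb{F}_p$. *)

(* Defs.v *)
From HB Require Import structures.
From mathcomp Require Import all_boot all_order all_algebra all_fingroup all_field.
Set Implicit Arguments.
Unset Strict Implicit.
Unset Printing Implicit Defensive.
Import GRing.Theory.
Local Open Scope ring_scope.

(* The field with p ^ n elements is an arbitrary L : fieldExtType 'F_p with
   \dim {:L} = n (for p prime). *)

(* The equality is one of formal polynomials, not of evaluation maps. *)
Definition DO_polynomial (p n : nat) (L : fieldExtType 'F_p) (g : {poly L}) :=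
  exists u : 'I_n -> 'I_n -> L,
    g = \sum_(i < n) \sum_(j < n | (i <= j)%N) u i j *: 'X^(p ^ i + p ^ j).

Definition DO_monomial (p n : nat) (L : fieldExtType 'F_p) (g : {poly L}) :=
  DO_polynomial n g /\ exists d : nat, g = 'X^d.

Definition Delta (R : comNzRingType) (g : {poly R}) (a : R) : {poly R} :=
  g \Po ('X + a%:P) - g - (g.[a])%:P.

Definition planar (R : comNzRingType) (g : {poly R}) :=
  forall a : R, a != 0 -> bijective (fun x : R => (Delta g a).[x]).

Section DeltaMatrices.
Variables (p n : nat) (L : fieldExtType 'F_p) (e : n.-tuple L) (g : {poly L}).

(* Column-vector convention: column j holds the coordinates of the image of
   e`_j, so that the matrix product represents composition of maps.  (The
   library's mxof is the transpose of this.) *)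
Definition DeltaM (a : L) : 'M['F_p]_n :=
  \matrix_(i, j) coord e i (Delta g a).[e`_j].

Definition inD (A : 'M['F_p]_n) := exists a : L, A = DeltaM a.

Definition inQuotD (A : 'M['F_p]_n) :=
  exists X Y : 'M['F_p]_n,
    [/\ inD X, inD Y, Y \in unitmx & A = X *m invmx Y].

End DeltaMatrices.

Definition is_field (R : unitRingType) :=
  commutative (@GRing.mul R) /\
  (forall x : R, x != 0 -> x \is a GRing.unit).

Definition ring_isomorphic (R S : nzRingType) :=
  exists f : {rmorphism R -> S}, bijective f.

(* Main.v *)
Require Import Defs.
From HB Require Import structures.
From mathcomp Require Import all_boot all_order all_algebra all_fingroup all_field.
From mathcomp Require Import ring.
Import GRing.Theory.
Local Open Scope ring_scope.

Set Implicit Arguments.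
Unset Strict Implicit.

(* Write g = X^(p^i + p^(i+s)), sigma x = x^(p^s), tau x = x^(p^i), and let L_u
   be multiplication by u.  Then M_a = tau B_a with
   B_a = L_a sigma + L_(sigma a), and
     B_(a h) = L_(a sigma(a)) B_h L_a^-1.
   With A = B_1 = sigma + 1 and E = sigma(h) - h <> 0, the identity
   A L_h = L_(sigma h) A - L_E gives
     B_h A^-1 = L_E A^-1 L_(sigma h) A L_E^-1
              = (L_E A^-1 sigma) L_h (L_E A^-1 sigma)^-1,
   while B_h A^-1 = L_h if E = 0.  So X = M_b M_a^-1 is conjugate to
   multiplication by c = a^-1 b, say X = f(c) with f(h) = P L_h P^-1, and f
   embeds the whole field into the matrices.  The conjugator P depends on c
   only through the factor D = sigma(c) - c (any D <> 0 if sigma(c) = c).  To see that f(h) is again a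
   quotient M_(a d h) M_(a d)^-1, it suffices to write
   D / (sigma(h) - h) = mu * d * sigma(d) with sigma(mu) = mu.  This is possible
   because planarity makes A injective, so sigma^2 and sigma have the same fixed
   points. *)

(** * Factorizations in finite fields *)

Lemma finField_prim_root (F : finFieldType) :
  exists z : F, #|F|.-1.-primitive_root z.
Proof.
have cardF : (0 < #|F|.-1)%N by rewrite -subn1 subn_gt0 finNzRing_gt1.
have /hasP[z _ zP] : has #|F|.-1.-primitive_root (enum (predC1 (0 : F))).
  apply: cyclic.has_prim_root; rewrite ?enum_uniq // -?cardE ?cardC1 //.
  apply/allP => x; rewrite mem_enum inE => x0.
  apply/unity_rootP/(mulfI x0); rewrite mulr1 -exprS prednK ?expf_card //.
  exact: ltnW (finNzRing_gt1 F).
by exists z.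
Qed.

(* With M = #|F| - 1, the hypothesis gives gcd(q^2 - 1, M) | q - 1, so that
   u^(q-1) = d^(q^2-1) for some power d of u; this makes u / (d * d^q) fixed by
   x |-> x^q. *)
Lemma expf_factor (F : finFieldType) (q : nat) (u : F) :
    (0 < q)%N -> (forall x : F, x ^+ (q * q) = x -> x ^+ q = x) -> u != 0 ->
  exists mu d : F, [/\ d != 0, mu ^+ q = mu & u = mu * (d * d ^+ q)].
Proof.
move=> q_gt0 fixP u0.
have [z zP] := finField_prim_root F.
set M := #|F|.-1 in zP; set r := (q * q).-1.
have M_gt0 := prim_order_gt0 zP.
have qqE : (q * q)%N = r.+1 by rewrite prednK // muln_gt0 q_gt0.
(* An element [w] of order [k] = gcd(q^2 - 1, M) is fixed by x |-> x^(q^2), hence by x |-> x^q, so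
   [k] divides q - 1. *)
have gq : (gcdn r M %| q.-1)%N.
  set k := gcdn r M; have kM : (k %| M)%N := dvdn_gcdr r M.
  have wP := dvdn_prim_root zP kM; set w := z ^+ _ in wP.
  rewrite (prim_order_dvd wP).
  have w0 : w != 0.
    by rewrite (prim_root_eq0 wP) -lt0n gcdn_gt0 M_gt0 orbT.
  rewrite -(inj_eq (mulfI w0)) -exprS prednK // mulr1 fixP //.
  apply/eqP; rewrite qqE exprS -[X in _ == X]mulr1 (inj_eq (mulfI w0)).
  by rewrite -(prim_order_dvd wP) dvdn_gcdl.
have uM : u ^+ M = 1.
  apply: (mulfI u0); rewrite -exprS mulr1 prednK ?expf_card //.
  exact: ltnW (finNzRing_gt1 F).
have [t tP] : exists t, u ^+ (t * r) = u ^+ q.-1.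
  (* If [r] is 0, the gcd is [M], so u^(q-1) = 1 and [t] = 0 works. Otherwise [t] is a multiple of
     the Bezout coefficient of [r] modulo [M]. *)
  case: (posnP r) => [r0|r_gt0].
    exists 0%N; move: gq; rewrite r0 gcd0n muln0 expr0 => /dvdnP[k ->].
    by rewrite mulnC exprM uM expr1n.
  case/dvdnP: gq => k ->; case: (egcdnP M r_gt0) => x y xy _.
  by exists (k * x)%N; rewrite -mulnA xy mulnDr exprD !mulnA mulnC exprM uM expr1n mul1r.
have d0 : u ^+ t != 0 by rewrite expf_neq0.
have v0 : u ^+ t * (u ^+ t) ^+ q != 0 by rewrite mulf_neq0 ?expf_neq0.
exists (u / (u ^+ t * (u ^+ t) ^+ q)), (u ^+ t); split=> //; last by rewrite divfK.
rewrite expr_div_n -exprM -exprD -exprM.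
have uq : u ^+ q = u * u ^+ (t * r) by rewrite tP -exprS prednK.
apply/eqP; rewrite eqr_div ?expf_neq0 ?mulf_neq0 //; apply/eqP.
rewrite uq -mulrA -exprS -!exprD -!exprS; congr (u ^+ _.+1).
by rewrite mulnDl -mulnA qqE mulnS addnCA addnA addnC.
Qed.

(** * Matrices of linear maps in a fixed basis *)

Section LinMx.
Variables (F : fieldType) (L : vectType F) (n : nat) (e : n.+1.-tuple L).
Hypothesis e_basis : basis_of {:L} e.

(** Columns are images of basis vectors, as in [DeltaM], so composition becomes the product in the
    same order. Plain functions are accepted, and linearity is asked only of the outer map in
    [linmx_comp]. *)
Definition linmx (f : L -> L) : 'M[F]_n.+1 :=
  \matrix_(i, j) coord e i (f e`_j).

Lemma eq_linmx f1 f2 : f1 =1 f2 -> linmx f1 = linmx f2.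
Proof. by move=> eqf; apply/matrixP => i j; rewrite !mxE eqf. Qed.

Lemma linmx_comp (f h : L -> L) : linear f -> linmx (f \o h) = linmx f * linmx h.
Proof.
move=> f_lin; pose fM := GRing.isLinear.Build _ _ _ _ f f_lin.
pose f' : {linear L -> L} := HB.pack f fM.
apply/matrixP => i j; rewrite !mxE /= -[f]/(f' : L -> L).
rewrite {1}(coord_basis e_basis (memvf (h e`_j))) !linear_sum.
by apply: eq_bigr => k _; rewrite !linearZ_LR !mxE mulrC.
Qed.

Lemma linmx_id : linmx id = 1.
Proof.
by apply/matrixP => i j; rewrite -[1]/(1%:M) !mxE coord_free ?(basis_free e_basis) // eq_sym.
Qed.

Lemma linmxD f1 f2 : linmx (fun x => f1 x + f2 x) = linmx f1 + linmx f2.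
Proof. by apply/matrixP => i j; rewrite !mxE linearD. Qed.

(** An injective linear map has a linear left inverse, and for square matrices a one-sided inverse
    suffices. *)
Lemma linmx_unit f : linear f -> injective f -> linmx f \in unitmx.
Proof.
move=> f_lin f_inj; pose fM := GRing.isLinear.Build _ _ _ _ f f_lin.
pose f' : {linear L -> L} := HB.pack f fM.
have kf : lker (linfun f') == 0%VS by apply/lker0P => x y; rewrite !lfunE; apply: f_inj.
have : linmx ((linfun f')^-1)%VF *m linmx f = 1%:M.
  rewrite -[LHS]/(_ * _) -[RHS]linmx_id -linmx_comp; last exact: linearP.
  by apply: eq_linmx => x /=; rewrite -{1}[f x](lfunE f') lker0_lfunK.
by case/mulmx1_unit.
Qed.
End LinMx.

(** * Algebras generated by one element, and their images under algebra morphisms *)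

(** The unit of [subvs_of] is by construction [algid]; this identifies it with the ambient 1. *)
Lemma algid_adjoin1 (K : fieldType) (A : falgType K) (x : A) :
  algid <<1; x>>%AS = 1.
Proof. by apply/eqP; rewrite algid_eq1; rewrite (subvP (sub1_agenv _)) ?memv_line. Qed.

Section AlgebraHom.
Variables (K : fieldType) (L : fieldExtType K) (M : falgType K) (f : 'AHom(L, M)) (x : L).

Lemma ahom_adjoin_preim (y : M) : y \in <<1; f x>>%VS -> exists2 z, z \in <<1; x>>%VS & y = f z.
Proof. by rewrite -(aimg1 f) -aimg_adjoin => /memv_imgP. Qed.

(** The inverse of [f z] is [f z^-1], and [z^-1] stays in the subfield generated by [x]. *)
Lemma ahom_adjoin_is_field : is_field (subvs_of <<1; f x>>%AS).
Proof.
have f_inj : injective f by apply/lker0P/AHom_lker0.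
split=> [u v|u u0].
  apply: val_inj => /=.
  have [z _ ->] := ahom_adjoin_preim (subvsP u).
  have [t _ ->] := ahom_adjoin_preim (subvsP v).
  by rewrite -!rmorphM mulrC.
have [z zx uz] := ahom_adjoin_preim (subvsP u).
have z0 : z != 0.
  by apply: contraNneq u0 => z0; apply/eqP/val_inj; rewrite /= uz z0 rmorph0.
have vP : f z^-1 \in <<1; f x>>%VS.
  by rewrite -(aimg1 f) -aimg_adjoin memv_img // memvV.
apply/unitrP; exists (Subvs vP); split; apply: val_inj;
 by rewrite /= uz -rmorphM /= ?mulVf ?mulfV // rmorph1 algid_adjoin1.
Qed.

Lemma ahom_adjoin_iso : ring_isomorphic (subvs_of <<1; f x>>%AS) (subvs_of <<1; x>>%AS).
Proof.
have f_inj : injective f by apply/lker0P/AHom_lker0.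
(* [f], being defined on a field, is injective and has a linear left inverse. [vsproj] only supplies
   the type: the preimage already lies in the subfield. *)
pose h (u : subvs_of <<1; f x>>%AS) : subvs_of <<1; x>>%AS :=
  vsproj <<1; x>> ((f^-1)%VF (vsval u)).
have hP u : f (vsval (h u)) = vsval u.
  have [z zx uz] := ahom_adjoin_preim (subvsP u).
  by rewrite /h uz lker0_lfunK ?AHom_lker0 // vsprojK.
have hB : zmod_morphism h.
  by move=> u v; apply/val_inj/f_inj; rewrite /= rmorphB /= !hP.
have hM : monoid_morphism h.
  split=> [|u v]; apply/val_inj/f_inj; rewrite ?rmorphM /= !hP //.
  by rewrite /= !algid_adjoin1 rmorph1.
pose hA := GRing.isZmodMorphism.Build _ _ h hB.
pose hMA := GRing.isMonoidMorphism.Build _ _ h hM.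
pose h' : {rmorphism subvs_of <<1; f x>>%AS -> subvs_of <<1; x>>%AS} := HB.pack h hA hMA.
have gP (v : subvs_of <<1; x>>%AS) : f (vsval v) \in <<1; f x>>%VS.
  by rewrite -(aimg1 f) -aimg_adjoin memv_img // subvsP.
exists h', (fun v => Subvs (gP v)).
- by move=> u; apply/val_inj; rewrite /= hP.
- by move=> v; apply/val_inj/f_inj; rewrite /= hP.
Qed.
End AlgebraHom.

Lemma conj_ahom (K : fieldType) (L A : falgType K) (m : {lrmorphism L -> A}) (P : A) :
  P \is a GRing.unit -> exists f : 'AHom(L, A), forall h, f h = P * m h / P.
Proof.
move=> unitP; pose f h := P * m h / P.
have f_lin : linear f.
  by move=> k x y; rewrite /f linearP mulrDr mulrDl -scalerAr -scalerAl.
pose f' : {linear L -> A} := HB.pack f (GRing.isLinear.Build _ _ _ _ f f_lin).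
have f_ahom : ahom_in {:L} (linfun f').
  apply/ahom_inP; split=> [x y _ _|]; rewrite !lfunE /= /f.
    by rewrite rmorphM !mulrA divrK.
  by rewrite rmorph1 mulr1 divrr.
by exists (AHom f_ahom) => h; rewrite lfunE.
Qed.

(** * The conjugation identities, in an abstract ring *)

Section TwistedConjugation.
Variables (L : fieldType) (R : unitRingType).
Variables (sigma : {rmorphism L -> L}) (m : {rmorphism L -> R}) (S T : R).
Hypothesis Sm : forall x, S * m x = m (sigma x) * S.
Hypotheses (unitS : S \is a GRing.unit) (unitT : T \is a GRing.unit).
Hypothesis unitS1 : S + 1 \is a GRing.unit.

(** This is B_x of the overview: [S] stands for sigma and [m] for multiplication operators. *)
Definition twist (x : L) : R := m x * S + m (sigma x).
(** The factor m D / (S + 1) * S conjugates m h into B_h A^-1; the prefix T * m (a * sigma a)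
    carries B_h A^-1 to M_(a h) M_a^-1. *)
Definition twistP (a D : L) : R := T * m (a * sigma a) * (m D / (S + 1) * S).

Let unitm x : x != 0 -> m x \is a GRing.unit.
Proof. by move=> x0; rewrite rmorph_unit ?unitfE. Qed.

Let mM x y : m (x * y) = m x * m y.
Proof. exact: rmorphM. Qed.

Lemma twistM x y : twist (x * y) * m x = m (x * sigma x) * twist y.
Proof.
rewrite /twist mulrDl -(mulrA (m (x * y))) Sm mulrDr !mulrA -!mM.
by rewrite (mulrAC x) (rmorphM sigma) (mulrC _ x) mulrA.
Qed.

Lemma twist1 : twist 1 = S + 1.
Proof. by rewrite /twist !rmorph1 mul1r. Qed.

Lemma twist_unit x : x != 0 -> twist x \is a GRing.unit.
Proof.
move=> x0; have -> : twist x = m (x * sigma x) * (S + 1) / m x.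
  apply: (mulIr (unitm x0)).
  by rewrite divrK ?unitm // -{1}[x]mulr1 twistM twist1.
by rewrite unitrMl ?unitrV ?unitm // unitrMl ?unitm ?mulf_neq0 ?fmorph_eq0.
Qed.

(** Written as an intertwining relation, so that no inverse of [m E] occurs. When [h] is fixed by
    sigma, [twist h] is m h * (S + 1) and [E] stays free. *)
Lemma twist_conj (E h : L) : sigma h = h \/ E = sigma h - h ->
  twist h / (S + 1) * (m E / (S + 1) * S) = m E / (S + 1) * S * m h.
Proof.
have SE : (S + 1) * m h = m (sigma h) * (S + 1) - m (sigma h - h).
  by rewrite mulrDl mulrDr Sm mul1r mulr1 rmorphB opprB -addrA (addrC (m (sigma h))) subrK.
move=> hE; rewrite -[RHS]mulrA Sm.
suff H : twist h / (S + 1) * m E = m E / (S + 1) * m (sigma h) * (S + 1).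
  by rewrite -[m E / _ * S]mulrA mulrA H -!mulrA [(S + 1) * _]mulrA divrr // mul1r.
case: hE => [hh|EE].
  have -> : twist h = m h * (S + 1) by rewrite /twist hh mulrDr mulr1.
  rewrite mulrK // -mM mulrC mM -!mulrA hh; congr (_ * _).
  by apply: (mulrI unitS1); rewrite mulVKr // SE hh subrr rmorph0 subr0.
have -> : twist h = m h * (S + 1) + m E.
  by rewrite /twist mulrDr mulr1 EE rmorphB -addrA (addrC (m h)) subrK.
rewrite mulrDl mulrK // mulrDl -[in RHS]mulrA -[m (sigma h) * (S + 1)](subrK (m E)).
by rewrite -EE in SE; rewrite -SE mulrDr -!mulrA mulKr // -!mM [E * h]mulrC.
Qed.

Lemma twistP_unit a D : a != 0 -> D != 0 -> twistP a D \is a GRing.unit.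
Proof.
move=> a0 D0.
by rewrite /twistP !unitrMl ?unitrV ?unitm ?mulf_neq0 ?fmorph_eq0.
Qed.

(** Passing from (a, D) to (a * d, E) changes the conjugator only by the factor [m mu], inserted
    before [Q]. As [mu] is fixed by sigma, [m mu] commutes with [S], hence with twist h / (S + 1),
    and the conjugate is unchanged. *)
Lemma twist_quotient a D E mu d h :
    a != 0 -> d != 0 -> E != 0 -> mu != 0 -> sigma mu = mu ->
    D = mu * (d * sigma d) * E -> sigma h = h \/ E = sigma h - h ->
  T * twist (a * d * h) / (T * twist (a * d)) = twistP a D * m h / twistP a D.
Proof.
move=> a0 d0 E0 mu0 mu_fix DE hE; set Q := m E / (S + 1) * S.
have ad0 : a * d != 0 by rewrite mulf_neq0.
set K := T * m (a * d * sigma (a * d)).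
have Kunit : K \is a GRing.unit.
  by rewrite unitrMl ?unitm // mulf_neq0 ?fmorph_eq0.
have PE : twistP a D = K * m mu * Q.
  have mD : m (a * sigma a) * m D = m (a * d * sigma (a * d)) * m mu * m E.
    rewrite -!mM DE (rmorphM sigma) (mulrACA a d) -!mulrA.
    by congr (m (_ * (_ * _))); rewrite mulrCA (mulrCA (sigma d)).
  by rewrite /twistP /K /Q -(mulrA T) !mulrA -(mulrA T) mD !mulrA.
have twE y : T * twist (a * d * y) = K * twist y / m (a * d).
  apply: (mulIr (unitm ad0)); rewrite divrK ?unitm //.
  by rewrite -mulrA twistM mulrA.
have twE1 : T * twist (a * d) = K * (S + 1) / m (a * d).
  by rewrite -twist1 -twE mulr1.
have mu_comm : twist h / (S + 1) * m mu = m mu * (twist h / (S + 1)).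
  have muS : S * m mu = m mu * S by rewrite Sm mu_fix.
  have muS1 : (S + 1) * m mu = m mu * (S + 1).
    by rewrite mulrDl mulrDr muS mul1r mulr1.
  have muV : (S + 1)^-1 * m mu = m mu / (S + 1).
    by apply: (mulrI unitS1); rewrite mulVKr // mulrA muS1 mulrK.
  rewrite -mulrA muV !mulrA; congr (_ / _).
  rewrite /twist mulrDl mulrDr -mulrA muS !mulrA -!mM.
  by congr (m _ * S + m _); rewrite mulrC.
have DD0 : D != 0 by rewrite DE !mulf_neq0 ?fmorph_eq0.
apply: (mulIr (twistP_unit a0 DD0)); rewrite divrK ?twistP_unit // -mulrA.
have -> : (T * twist (a * d))^-1 * twistP a D = m (a * d) / (S + 1) * m mu * Q.
  have U : T * twist (a * d) \is a GRing.unit.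
    by rewrite twE1 unitrMl ?unitrV ?unitm // unitrMl.
  by apply: (mulrI U); rewrite mulVKr // PE twE1 !mulrA divrK ?unitm // mulrK.
have QC : twist h / (S + 1) * Q = Q * m h by apply: twist_conj.
transitivity (K * (twist h / (S + 1) * m mu) * Q).
  by rewrite twE !mulrA divrK ?unitm.
by rewrite mu_comm PE -!(mulrA K) -(mulrA (m mu)) QC !mulrA.
Qed.
End TwistedConjugation.

(** * Frobenius powers and Dembowski-Ostrom monomials *)

Section Frobenius.
Variables (p : nat) (p_prime : prime p) (L : fieldExtType 'F_p).

Definition frob (k : nat) (x : L) : L := x ^+ (p ^ k).

Lemma frobD k x y : frob k (x + y) = frob k x + frob k y.
Proof.
have pcharL : p \in [pchar L] by rewrite pchar_lalg pchar_Fp.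
by rewrite /frob exprDn_pchar // (eq_pnat _ (pcharf_eq pcharL)) pnatX pnat_id.
Qed.

Lemma frob_monoid k : monoid_morphism (frob k).
Proof. by split=> [|x y]; rewrite /frob ?expr1n ?exprMn. Qed.

Lemma frobN k x : frob k (- x) = - frob k x.
Proof.
have f0 : frob k 0 = 0 by rewrite /frob expr0n expn_eq0 -leqn0 leqNgt prime_gt0.
by apply/eqP; rewrite -addr_eq0 -frobD addNr f0.
Qed.

Lemma frob_zmod k : zmod_morphism (frob k).
Proof. by move=> x y; rewrite frobD frobN. Qed.

Definition frob_rmorphism k : {rmorphism L -> L} := HB.pack (frob k)
  (GRing.isZmodMorphism.Build L L (frob k) (frob_zmod k))
  (GRing.isMonoidMorphism.Build L L (frob k) (frob_monoid k)).

Lemma frob_linear k : linear (frob k).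
Proof.
move=> c x y; rewrite frobD; congr (_ + _).
rewrite /frob exprZn; congr (_ *: _).
elim: k => [|k IHk]; first by rewrite expn0 expr1.
by rewrite expnS exprM; have := expf_card c; rewrite card_Fp // => ->.
Qed.

Lemma frob_inj k : injective (frob k).
Proof. exact: fmorph_inj (frob_rmorphism k). Qed.

(** Additivity of Frobenius powers leaves only the two mixed products of (x + a)^(p^i) (x +
    a)^(p^(i+s)). *)
Lemma horner_DeltaXn i s (a x : L) :
  (Delta 'X^(p ^ i + p ^ (i + s)) a).[x] =
    frob i (a * frob s x + frob s a * x).
Proof.
rewrite /Delta !hornerE horner_comp !hornerE !exprD.
rewrite -!/(frob _ _) !frobD.
have frobA y : frob (i + s) y = frob i (frob s y).
  by rewrite /frob -exprM mulnC -expnD addnC.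
by rewrite !(frob_monoid _).2 !frobA; ring.
Qed.
End Frobenius.

(** Compare coefficients at [d]: the monomial has 1 there, whereas the sum has 0 unless [d] is one
    of its exponents. *)
Lemma DO_monomial_exp (p n : nat) (L : fieldExtType 'F_p) (g : {poly L}) :
  DO_monomial n g -> exists i s, g = 'X^(p ^ i + p ^ (i + s)).
Proof.
case=> [[u gE] [d gd]]; rewrite gd in gE *.
have [|nd] := boolP [exists i : 'I_n, exists j : 'I_n,
                      (i <= j)%N && (d == p ^ i + p ^ j)%N].
  case/existsP=> i /existsP[j /andP[ij /eqP->]].
  by exists (i : nat), (j - i)%N; rewrite subnKC.
have /eqP := congr1 (fun q : {poly L} => q`_d) gE.
rewrite coefXn eqxx coef_sum big1 ?oner_eq0 // => i _.
rewrite coef_sum big1 // => j ij; rewrite coefZ coefXn.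
case: eqP => [dE|]; last by rewrite mulr0.
by case/existsP: nd; exists i; apply/existsP; exists j; rewrite ij dE eqxx.
Qed.

(** If sigma^2 x = x, then sigma + 1 kills sigma x - x, so sigma x = x; this is the fixed-point
    hypothesis of [expf_factor] for q = p^s. *)
Lemma frob_factor (p : nat) (p_prime : prime p) (L : fieldExtType 'F_p)
    (s : nat) (u : L) :
    (forall x : L, frob s x + x = 0 -> x = 0) -> u != 0 ->
  exists mu d : L,
    [/\ d != 0, frob s mu = mu & u = mu * (d * frob s d)].
Proof.
move=> inj u0; apply: (@expf_factor (finvect_type L)) => //.
  by rewrite expn_gt0 prime_gt0.
move=> x; rewrite exprM => xqq; apply/eqP; rewrite -subr_eq0; apply/eqP.
apply: (inj (frob s (x : L) - x)).
by rewrite (frob_zmod p_prime) [frob s (frob s (x : L))]xqq addrA subrK subrr.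
Qed.

(** * Quotients of difference matrices of a planar monomial *)

Section Planar.
Variables (p n : nat) (p_prime : prime p) (L : fieldExtType 'F_p).
Variables (e : n.+1.-tuple L) (e_basis : basis_of {:L} e) (i s : nat).
Let g : {poly L} := 'X^(p ^ i + p ^ (i + s)).
Hypothesis g_planar : planar g.

(** In direction 1 the difference map is [frob i] after sigma + 1, so [x] and 0 have the same
    image. *)
Lemma planar_frob_inj (x : L) : frob s x + x = 0 -> x = 0.
Proof.
move=> x0; apply: (bij_inj (g_planar (oner_neq0 L))).
rewrite !horner_DeltaXn // /frob expr1n !mul1r expr0n expn_eq0.
rewrite -leqn0 leqNgt prime_gt0 // addr0 -[LHS]/(frob i _) x0.
by rewrite /frob expr0n expn_eq0 -leqn0 leqNgt prime_gt0.
Qed.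

Let sigma := frob_rmorphism p_prime L s.

Let mulmx_fun (a : L) : 'M['F_p]_n.+1 := linmx e ( *%R a).

Lemma mul_linear (a : L) : linear ( *%R a : L -> L).
Proof. by move=> k x y; rewrite mulrDr scalerAr. Qed.

Lemma mulmx_fun_zmod : zmod_morphism mulmx_fun.
Proof. by move=> a b; apply/matrixP => j k; rewrite !mxE mulrBl raddfB. Qed.

Lemma mulmx_fun_monoid : monoid_morphism mulmx_fun.
Proof.
split=> [|a b].
  by rewrite -(linmx_id e_basis); apply: eq_linmx => x; rewrite mul1r.
rewrite -(linmx_comp e_basis); last exact: mul_linear.
by apply: eq_linmx => x; rewrite /= mulrA.
Qed.

Lemma mulmx_fun_scalable : scalable mulmx_fun.
Proof. by move=> k a; apply/matrixP => u v; rewrite !mxE -scalerAl linearZ. Qed.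

Let m : {lrmorphism L -> 'M['F_p]_n.+1} := HB.pack mulmx_fun
  (GRing.isScalable.Build _ _ _ _ mulmx_fun mulmx_fun_scalable)
  (GRing.isZmodMorphism.Build _ _ mulmx_fun mulmx_fun_zmod)
  (GRing.isMonoidMorphism.Build _ _ mulmx_fun mulmx_fun_monoid).

Let S := linmx e (frob s).
Let T := linmx e (frob i).

Let unitS : S \is a GRing.unit.
Proof.
by apply: (linmx_unit e_basis); [apply: frob_linear | apply: frob_inj].
Qed.

Let unitT : T \is a GRing.unit.
Proof.
by apply: (linmx_unit e_basis); [apply: frob_linear | apply: frob_inj].
Qed.

Let unitS1 : S + 1 \is a GRing.unit.
Proof.
rewrite -(linmx_id e_basis) -linmxD.
have lin : linear (fun x : L => frob s x + x).
  by move=> k x y; rewrite (frob_linear p_prime) scalerDr addrACA.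
apply: (linmx_unit e_basis lin) => x y xy.
apply/eqP; rewrite -subr_eq0; apply/eqP/planar_frob_inj.
by rewrite (frob_zmod p_prime) addrACA -opprD xy subrr.
Qed.

Let Sm (x : L) : S * m x = m (sigma x) * S.
Proof.
rewrite -!(linmx_comp e_basis); [|exact: mul_linear|exact: frob_linear].
by apply: eq_linmx => y /=; rewrite /frob exprMn.
Qed.

Lemma DeltaM_twist (a : L) : DeltaM e g a = T * twist sigma m S a.
Proof.
rewrite /twist -[m a * S](linmx_comp e_basis); last exact: mul_linear.
rewrite -linmxD -(linmx_comp e_basis); last exact: frob_linear.
by apply/matrixP => j k; rewrite !mxE horner_DeltaXn.
Qed.

Lemma DeltaM_unit (a : L) : a != 0 -> DeltaM e g a \in unitmx.
Proof.
move=> a0; have U := twist_unit Sm unitS1 a0.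
have := unitrMl T U; rewrite unitT -DeltaM_twist; exact.
Qed.

(** The conjugator is fixed by [a] and [c] alone, so a single morphism sends [c] to the given
    quotient and every other [h] to some quotient. *)
Lemma planar_field_embedding (a c : L) : a != 0 ->
  exists f : 'AHom(L, 'M['F_p]_n.+1),
    f c = DeltaM e g (a * c) / DeltaM e g a
    /\ forall h : L, inQuotD e g (f h).
Proof.
move=> a0.
have [D D0 Dc] : exists2 D : L, D != 0 & sigma c = c \/ D = sigma c - c.
  case: (eqVneq (sigma c) c) => [cc|cc]; first by exists 1; [exact: oner_neq0 | left].
  by exists (sigma c - c); [rewrite subr_eq0 | right].
pose P := twistP sigma m S T a D.
have unitP : P \is a GRing.unit.
  exact: (@twistP_unit _ _ sigma m S T unitS unitT unitS1 a D a0 D0).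
have quot E mu d h := @twist_quotient _ _ sigma m S T Sm unitS unitT unitS1 a D E mu d h a0.
have [f fE] := conj_ahom m unitP.
exists f; split=> [|h]; rewrite fE.
  (* For h = c one takes E = D and mu = d = 1. *)
  rewrite -(quot D 1 1) ?oner_eq0 ?rmorph1 ?mul1r ?mulr1 // -?DeltaM_twist //.
have [mu [d [E [d0 mu_fix DE E0 hE]]]] : exists mu d E, [/\ d != 0, sigma mu = mu,
    D = mu * (d * sigma d) * E, E != 0 & sigma h = h \/ E = sigma h - h].
  (* For [h] fixed by sigma, E = D serves again. Otherwise E = sigma h - h is forced, and D / E is
     factored to find [mu] and [d]. *)
  case: (eqVneq (sigma h) h) => [hh|]; last rewrite -subr_eq0 => E0.
    by exists 1, 1, D; rewrite oner_neq0 !rmorph1 !mul1r; split=> //; left.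
  have [|mu [d [d0 mu_fix DE]]] :=
      frob_factor p_prime planar_frob_inj (u := D / (sigma h - h)).
    by rewrite mulf_neq0 ?invr_eq0.
  by exists mu, d, (sigma h - h); split=> //; [rewrite -DE divfK | right].
have mu0 : mu != 0 by apply: contraNneq D0 => mu0; rewrite DE mu0 !mul0r.
exists (DeltaM e g (a * d * h)), (DeltaM e g (a * d)); split.
- by exists (a * d * h).
- by exists (a * d).
- by apply: DeltaM_unit; rewrite mulf_neq0.
- by rewrite -(quot E mu d) // -!DeltaM_twist.
Qed.
End Planar.

Unset Implicit Arguments.
Set Strict Implicit.

Theorem theorem4 (p n : nat) (p_prime : prime p) (p_odd : odd p)
    (L : fieldExtType 'F_p) (dimL : \dim {:L} = n.+1)
    (e : n.+1.-tuple L) (e_basis : basis_of {:L} e)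
    (g : {poly L}) (g_DO : DO_monomial n.+1 g) (g_planar : planar g)
    (a b : L) (a_neq0 : a != 0) (b_neq0 : b != 0) :
  let X : 'M['F_p]_n.+1 := DeltaM e g b *m invmx (DeltaM e g a) in
  [/\ DeltaM e g a \in unitmx /\ inQuotD e g X,
      is_field (subvs_of <<1; X>>%AS),
      ring_isomorphic (subvs_of <<1; X>>%AS) (subvs_of <<1; a^-1 * b>>%AS)
    & forall A : 'M['F_p]_n.+1, A \in <<1; X>>%VS -> inQuotD e g A].
Proof.
move=> X; have [i [s gE]] := DO_monomial_exp g_DO; subst g.
have unit_a := DeltaM_unit p_prime e_basis g_planar a_neq0.
have [f [fX f_quot]] :=
  planar_field_embedding p_prime e_basis g_planar (a^-1 * b) a_neq0.
rewrite mulVKf // in fX.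
(* Now F_p[X] is the image under [f] of the subfield generated by a^-1 b, which yields all the
   remaining claims. *)
have -> : X = f (a^-1 * b) by rewrite fX.
split.
- by split.
- exact: ahom_adjoin_is_field.
- exact: ahom_adjoin_iso.
- by move=> A /ahom_adjoin_preim[z _ ->].
Qed.
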